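(* Let $X$ be a $T_D$-space. A subset $F$ of $X$ is maximal nowhere dense in $X$ if and only if the induced sublocale $\widetilde{F}$ is maximal nowhere dense in the locale $\mathfrak{O}X$ of open subsets of $X$.
   Context: A space $X$ is $T_D$ if every $x\in X$ has an open neighbourhood $U$ such that $U\smallsetminus\{x\}$ is open. For $A\subseteq X$, the sublocale of $\mathfrak{O}X$ induced by $A$ is $\widetilde{A}=\{\mathrm{int}((X\smallsetminus A)\cup G):G\in\mathfrak{O}X\}$. A subset of a space is nowhere dense if the interior of its closure is empty. A nowhere dense subset $N$ of $X$ is maximal nowhere dense if there is no nowhere dense subset $K$ of $X$ with $N\subseteq K$ such that $N$ is nowhere dense in the subspace $K$. A sublocale $N$ of a locale $L$ is nowhere dense if $N\cap\mathfrak{B}L=\{1\}$, where $\mathfrak{B}L=\{x\to 0:x\in L\}$. For a sublocale $S$ of $L$, ''$N$ is nowhere dense in $S$'' means $N\subseteq S$ and $N$ is a nowhere dense sublocale of the locale $S$. A nowhere dense sublocale $N$ of $L$ is maximal nowhere dense if there is no nowhere dense sublocale $S$ of $L$ such that $N$ is nowhere dense in $S$. *)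

(* Defs.v *)
From HB Require Import structures.
From mathcomp Require Import all_boot all_order.
From mathcomp Require Import boolp classical_sets functions topology.

Set Implicit Arguments.
Unset Strict Implicit.
Unset Printing Implicit Defensive.

Import Order.TTheory.

Local Open Scope order_scope.
Local Open Scope classical_set_scope.

(* Locales are represented by the corresponding frames. [fjoin] is the
   operation of arbitrary joins and [supremums A] is the library's set of least
   upper bounds of [A]. *)
HB.mixin Record TBLattice_isFrame d T of Order.TBLattice d T := {
  fjoin : set T -> T;
  fjoin_supremums : forall A : set T, supremums A (fjoin A);
  meet_fjoin : forall (x : T) (A : set T),
    Order.meet x (fjoin A) = fjoin [set Order.meet x a | a in A];
}.

#[short(type="frameType")]
HB.structure Definition Frame d :=
  { T of TBLattice_isFrame d T & Order.TBLattice d T }.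

HB.factory Record POrder_isFrame d T of Order.POrder d T := {
  meet : T -> T -> T;
  fjoin : set T -> T;
  meetP : forall x y z, (x <= meet y z) = (x <= y) && (x <= z);
  fjoin_supremums : forall A : set T, supremums A (fjoin A);
  meet_fjoin_le : forall (x t : T) (A : set T),
    (forall a, A a -> meet x a <= t) -> meet x (fjoin A) <= t;
}.

HB.builders Context d T of POrder_isFrame d T.

Let fj_ub (A : set T) a : A a -> a <= fjoin A.
Proof. by have [+ _] := fjoin_supremums A; apply. Qed.

Let fj_le (A : set T) t : (forall a, A a -> a <= t) -> fjoin A <= t.
Proof. by have [_ +] := fjoin_supremums A; apply. Qed.

Let join x y := fjoin [set z | z = x \/ z = y].

Let joinP x y z : (join x y <= z) = (x <= z) && (y <= z).
Proof.
apply/idP/andP => [h|[xz yz]]; last by apply: fj_le => _ [] ->.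
by split; apply: le_trans h; apply: fj_ub; [left|right].
Qed.

HB.instance Definition _ :=
  @Order.POrder_MeetJoin_isLattice.Build d T meet join meetP joinP.

Let le0 x : fjoin set0 <= x. Proof. exact: fj_le. Qed.
HB.instance Definition _ := @Order.hasBottom.Build d T (fjoin set0) le0.

Let le1 x : x <= fjoin setT. Proof. exact: fj_ub. Qed.
HB.instance Definition _ := @Order.hasTop.Build d T (fjoin setT) le1.

Let meet_fj (x : T) (A : set T) :
  Order.meet x (fjoin A) = fjoin [set Order.meet x a | a in A].
Proof.
apply/le_anti/andP; split.
  by apply: meet_fjoin_le => a Aa; apply: fj_ub; exists a.
apply: fj_le => _ [a Aa <-]; rewrite lexI leIl /=.
by apply: le_trans (leIr _ _) _; apply: fj_ub.
Qed.

HB.instance Definition _ :=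
  @TBLattice_isFrame.Build d T fjoin fjoin_supremums meet_fj.
HB.end.

Section frame.
Local Open Scope order_scope.
Context {d : Order.disp_t} {L : frameType d}.
Implicit Types (x y z : L) (A : set L).

Definition fmeet A : L := fjoin (lbound A).

(* Heyting implication *)
Definition fimp x y : L := fjoin [set z | z `&` x <= y].

Lemma fjoin_ub A a : A a -> a <= fjoin A.
Proof. by have [+ _] := fjoin_supremums A; apply. Qed.

Lemma fjoin_le A x : (forall a, A a -> a <= x) -> fjoin A <= x.
Proof. by have [_ +] := fjoin_supremums A; apply. Qed.

Lemma fmeet_lb A a : A a -> fmeet A <= a.
Proof. by move=> Aa; apply: fjoin_le => x; apply. Qed.

Lemma fmeet_ge A x : (forall a, A a -> x <= a) -> x <= fmeet A.
Proof. by move=> xA; exact: fjoin_ub. Qed.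

Lemma fimpP x y z : (z <= fimp x y) = (z `&` x <= y).
Proof.
apply/idP/idP => [h|]; last by move=> h; apply: fjoin_ub.
apply: le_trans (leI2 h (lexx x)) _.
by rewrite meetC meet_fjoin; apply: fjoin_le => _ [a + <-]; rewrite /= meetC.
Qed.

(* Taking [A] empty gives [S \top]. *)
Definition is_sublocale (S : set L) : Prop :=
  (forall A, A `<=` S -> S (fmeet A)) /\ (forall x s, S s -> S (fimp x s)).

End frame.

Record sublocale d (L : frameType d) := Sublocale {
  sublocale_set :> set L;
  sublocaleP : is_sublocale sublocale_set }.

(* A sublocale is a locale in the order inherited from the ambient locale. *)
Definition sublocale_type d (L : frameType d) (S : sublocale L) : Type :=
  set_type (S : set L).

Section sublocale_frame.
Local Open Scope order_scope.
Context {d : Order.disp_t} {L : frameType d} (S : sublocale L).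

HB.instance Definition _ := SubChoice.on (sublocale_type S).
HB.instance Definition _ :=
  [SubChoice_isSubPOrder of sublocale_type S by <: with d].

Lemma le_sublocale (u v : sublocale_type S) : (u <= v) = (val u <= val v).
Proof. by rewrite -Order.le_val. Qed.

Definition to_sublocale x (Sx : sublocale_set S x) : sublocale_type S :=
  exist _ x (mem_set Sx).

Lemma sublocale_valP (u : sublocale_type S) : sublocale_set S (val u).
Proof. by case: u => x /= /set_mem. Qed.

Let S_meet x y :
  sublocale_set S x -> sublocale_set S y -> sublocale_set S (x `&` y).
Proof.
move=> Sx Sy; have -> : x `&` y = fmeet [set z | z = x \/ z = y].
  apply/le_anti/andP; split.
    by apply: fmeet_ge => _ [] ->; [exact: leIl|exact: leIr].
  by rewrite lexI; apply/andP; split; apply: fmeet_lb; [left|right].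
by apply: (sublocaleP S).1 => _ [] ->.
Qed.

Let smeet (u v : sublocale_type S) := to_sublocale (S_meet (sublocale_valP u) (sublocale_valP v)).

Let S_bound (A : set (sublocale_type S)) :
  sublocale_set S
    (fmeet [set x | sublocale_set S x /\ forall a, A a -> val a <= x]).
Proof. by apply: (sublocaleP S).1 => x []. Qed.

Let sjoin A := to_sublocale (S_bound A).

Let smeetP u v w : (u <= smeet v w) = (u <= v) && (u <= w).
Proof. by rewrite !le_sublocale lexI. Qed.

Let sjoin_supremums (A : set (sublocale_type S)) : supremums A (sjoin A).
Proof.
split=> [a Aa|u Au]; rewrite le_sublocale /=.
  by apply: fmeet_ge => x [_]; apply.
apply: fmeet_lb; split=> [|a Aa]; first exact: sublocale_valP.
by have := Au a Aa; rewrite le_sublocale.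
Qed.

Let smeet_sjoin (u t : sublocale_type S) (A : set (sublocale_type S)) :
  (forall a, A a -> smeet u a <= t) -> smeet u (sjoin A) <= t.
Proof.
move=> At; rewrite le_sublocale /= meetC -fimpP.
apply: fmeet_lb; split=> [|a Aa]; first exact: (sublocaleP S).2 (sublocale_valP t).
by rewrite fimpP meetC; have := At a Aa; rewrite le_sublocale.
Qed.

HB.instance Definition _ := @POrder_isFrame.Build d (sublocale_type S)
  smeet sjoin smeetP sjoin_supremums smeet_sjoin.

End sublocale_frame.

Section sublocale_within.
Local Open Scope order_scope.
Context {d : Order.disp_t} {L : frameType d} (N S : sublocale L).

Let within : set (sublocale_type S) := [set u | sublocale_set N (val u)].

Lemma is_sublocale_within : N `<=` S -> is_sublocale within.
Proof.
move=> NS; split=> [A AN|u s Ns].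
- have N_A : sublocale_set N (fmeet (val @` A)).
    by apply: (sublocaleP N).1 => _ [a Aa <-]; exact: AN.
  suff : val (fmeet A) = fmeet (val @` A) by rewrite /within /= => ->.
  apply/le_anti/andP; split.
    by apply: fmeet_ge => _ [a Aa <-]; rewrite -le_sublocale; exact: fmeet_lb.
  pose m : sublocale_type S := to_sublocale (NS _ N_A).
  have -> : fmeet (val @` A) = val m by [].
  rewrite -le_sublocale; apply: fmeet_ge => a Aa.
  by rewrite le_sublocale; apply: fmeet_lb; exists a.
- have N_i : sublocale_set N (fimp (val u) (val s)) by exact: (sublocaleP N).2.
  suff : val (fimp u s) = fimp (val u) (val s) by rewrite /within /= => ->.
  pose i : sublocale_type S := to_sublocale (NS _ N_i).
  apply/le_anti/andP; split.
    have : fimp u s `&` u <= s by rewrite -fimpP.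
    by rewrite fimpP le_sublocale.
  have -> : fimp (val u) (val s) = val i by [].
  rewrite -le_sublocale fimpP le_sublocale.
  by rewrite (_ : val (i `&` u) = val i `&` val u)// -fimpP.
Qed.

Definition sublocale_within (NS : N `<=` S) :
    sublocale (sublocale_type S) :=
  Sublocale (is_sublocale_within NS).

End sublocale_within.

Definition booleanization d (L : frameType d) : set L :=
  range (fun x : L => fimp x \bot).
Arguments booleanization {d} L.

Definition sublocale_nowhere_dense d (L : frameType d)
    (N : sublocale L) : Prop :=
  N `&` booleanization L = [set \top].

Definition sublocale_nowhere_dense_in d (L : frameType d)
    (N S : sublocale L) : Prop :=
  exists NS : N `<=` S, sublocale_nowhere_dense (sublocale_within NS).

Definition sublocale_maximal_nowhere_dense d (L : frameType d)
    (N : sublocale L) : Prop :=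
  sublocale_nowhere_dense N /\
  ~ exists S : sublocale L,
      sublocale_nowhere_dense S /\ sublocale_nowhere_dense_in N S.

Definition TD_space (X : topologicalType) : Prop :=
  forall x : X, exists U : set X, [/\ open U, U x & open (U `\ x)].

Definition nowhere_dense (X : topologicalType) (A : set X) : Prop :=
  (closure A)° = set0.

(* [K : Type] is the library's [set_type K], with the subspace topology. *)
Definition nowhere_dense_in (X : topologicalType) (N K : set X) : Prop :=
  N `<=` K /\ nowhere_dense ((set_val : K -> X) @^-1` N).

Definition maximal_nowhere_dense (X : topologicalType) (N : set X) : Prop :=
  nowhere_dense N /\
  ~ exists K : set X, nowhere_dense K /\ nowhere_dense_in N K.

Definition opens (X : topologicalType) : Type := set_type (@open X).

Section opens_frame.
Context {X : topologicalType}.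
Implicit Types U V G : opens X.

HB.instance Definition _ := SubChoice.on (opens X).
HB.instance Definition _ := [SubChoice_isSubPOrder of opens X by <:
  with Order.Disp tt tt].

Definition mkopens (A : set X) (oA : open A) : opens X :=
  exist _ A (mem_set oA).

Lemma opensP U : open (val U). Proof. by case: U => x /= /set_mem. Qed.

Lemma le_opens U V : (U <= V) = `[< val U `<=` val V >].
Proof. by rewrite -Order.le_val. Qed.

Let omeet U V : opens X := mkopens (openI (opensP U) (opensP V)).

Let ojoin (A : set (opens X)) : opens X :=
  mkopens (bigcup_open (D := A) (f := val) (fun U _ => opensP U)).

Let omeetP U V G : (U <= omeet V G) = (U <= V) && (U <= G).
Proof.
rewrite !le_opens; apply/asboolP/andP => /= [h|[/asboolP h1 /asboolP h2]].
  by split; apply/asboolP => x /h[].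
by move=> x Ux; split; [exact: h1|exact: h2].
Qed.

Let ojoin_supremums (A : set (opens X)) : supremums A (ojoin A).
Proof.
split=> [U AU|U AU]; rewrite le_opens; apply/asboolP => /= x.
  by exists U.
by move=> [V /AU]; rewrite le_opens => /asboolP; apply.
Qed.

Let omeet_ojoin U V (A : set (opens X)) :
  (forall G, A G -> omeet U G <= V) -> omeet U (ojoin A) <= V.
Proof.
move=> AV; rewrite le_opens; apply/asboolP => /= x [Ux [G /AV + Gx]].
by rewrite le_opens => /asboolP; apply.
Qed.

HB.instance Definition _ := @POrder_isFrame.Build _ (opens X)
  omeet ojoin omeetP ojoin_supremums omeet_ojoin.

Definition opens_interior (A : set X) : opens X :=
  mkopens (open_interior A).

Definition induced_set (A : set X) : set (opens X) :=
  range (fun G : opens X => opens_interior (~` A `|` val G)).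

Lemma induced_setP (A : set X) U :
  induced_set A U <-> opens_interior (~` A `|` val U) <= U.
Proof.
split=> [[G _ <-]|UU].
  rewrite le_opens; apply/asboolP => /=.
  rewrite -open_subsetE; last exact: open_interior.
  apply: subset_trans (@interior_subset _ _) _ => x [?|]; first by left.
  exact: interior_subset.
exists U => //; apply/le_anti; rewrite UU /= le_opens; apply/asboolP => /=.
by rewrite -open_subsetE; [exact: subsetUr|exact: opensP].
Qed.

Lemma is_sublocale_induced (A : set X) : is_sublocale (induced_set A).
Proof.
have mono (B C : set X) : B `<=` ~` A `|` C ->
    (~` A `|` B)° `<=` (~` A `|` C)°.
  by move=> BC; apply: interiorS => x [?|/BC//]; left.
split=> [F FA|U V /induced_setP VA]; apply/induced_setP.
  apply: fmeet_ge => U FU; have /induced_setP := FA _ FU.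
  apply: le_trans; rewrite le_opens; apply/asboolP/mono => x.
  by move: (fmeet_lb FU); rewrite le_opens => /asboolP h /h; right.
rewrite fimpP; apply: le_trans VA; rewrite le_opens; apply/asboolP => /=.
rewrite -open_subsetE; last exact: openI (open_interior _) (opensP U).
have : (fimp U V `&` U <= V)%O by rewrite -fimpP.
rewrite le_opens => /asboolP h x [/interior_subset [?|i] Ux]; first by left.
by right; apply: h.
Qed.

Definition induced_sublocale (A : set X) : sublocale (opens X) :=
  Sublocale (is_sublocale_induced A).

End opens_frame.

(* Main.v *)
Require Import Defs.
From mathcomp Require Import all_boot all_order.
From mathcomp Require Import boolp classical_sets functions topology.

(* Both notions of maximality only see the closure of [F]. For a sublocale [N]
   with least element [n], [N] is nowhere dense iff the pseudocomplement of [n]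
   vanishes, and [N] is nowhere dense in a sublocale with least element [s] iff
   [n -> s = s]. Hence a witness of non-maximality can be replaced by the closed
   sublocale above its least element. On the side of spaces, a witness [K] can
   likewise be replaced by its closure. The least element of the sublocale
   induced by [F] is the complement of the closure of [F], and for a closed [C]
   containing [F], with complement [V], [F] is nowhere dense in [C] iff the
   Heyting implication from the complement of [closure F] to [V] is [V]. *)

Import Order.TTheory.
Local Open Scope order_scope.
Local Open Scope classical_set_scope.

Section locale.
Context {d : Order.disp_t} {L : frameType d}.
Implicit Types (x y : L) (N : sublocale L).

Lemma le_fimpr x y : y <= fimp x y.
Proof. by rewrite fimpP leIl. Qed.

Lemma fmeet_sublocale N : sublocale_set N (fmeet N).
Proof. exact: (sublocaleP N).1. Qed.

Lemma sublocale_top N : sublocale_set N \top%O.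
Proof.
suff -> : \top%O = fmeet (set0 : set L) by exact: (sublocaleP N).1.
by apply/le_anti; rewrite lex1 andbT; apply: fmeet_ge.
Qed.

Lemma fimp_eq_bot x : fimp x \bot%O = \top%O -> x = \bot%O.
Proof.
move=> h; apply/le_anti; rewrite le0x andbT.
by rewrite -(meet1x x) -fimpP h.
Qed.

(** With [n] the least element of [N], the double pseudocomplement of [n] lies in both [N] and the
    Booleanization. Conversely, if [fimp x \bot] is in [N], it is above [n], so [x] is disjoint from
    [n] and lies below the pseudocomplement of [n]. *)
Lemma sublocale_nowhere_denseP N :
  sublocale_nowhere_dense N <-> fimp (fmeet N) \bot = \bot :> L.
Proof.
set n := fmeet N; split=> [h|h].
- apply: fimp_eq_bot.
  (* As [n] is disjoint from its pseudocomplement, [\bot] may be replaced by [n]; closure of [N]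
     under implication then applies. *)
  have nn : fimp (fimp n \bot) n = fimp (fimp n \bot) \bot.
    apply/le_anti/andP; split; rewrite fimpP.
      set y := fimp n \bot.
      have : (fimp y n `&` y <= n `&` y)%O by rewrite lexI leIr -fimpP lexx.
      by move/le_trans; apply; rewrite meetC -fimpP.
    by apply: le_trans (le0x n); rewrite -fimpP.
  have : (N `&` booleanization L) (fimp (fimp n \bot) \bot).
    split; last by exists (fimp n \bot).
    by rewrite -nn; apply: (sublocaleP N).2; exact: fmeet_sublocale.
  by rewrite h.
- apply/seteqP; split=> [y [] + [x _ xy]|_ ->] /=.
    rewrite -{y}xy => /fmeet_lb; rewrite fimpP meetC -fimpP h => x0.
    apply/le_anti; rewrite lex1 fimpP /=.
    exact: le_trans (leIr _ _) x0.
  split; first exact: sublocale_top.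
  by exists \bot%O => //; apply/le_anti; rewrite lex1 fimpP leIr.
Qed.

End locale.

Section within.
Context {d : Order.disp_t} {L : frameType d} (S : sublocale L).
Implicit Types N : sublocale L.

(** The implication of [L] already lies in [S], and binary meets in [S] are those of [L], so it has
    the universal property in [S] too. *)
Lemma val_fimp (u v : sublocale_type S) :
  val (fimp u v) = fimp (val u) (val v).
Proof.
have Si : sublocale_set S (fimp (val u) (val v)).
  by apply: (sublocaleP S).2; exact: sublocale_valP.
apply/le_anti/andP; split.
  have : (fimp u v `&` u <= v)%O by rewrite -fimpP.
  by rewrite fimpP le_sublocale.
rewrite -[X in X <= _]/(val (to_sublocale Si)) -le_sublocale fimpP le_sublocale.
by rewrite -[X in X <= _]/(fimp (val u) (val v) `&` val u)%O -fimpP.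
Qed.

Lemma val_sublocale_bot : val (\bot%O : sublocale_type S) = fmeet S.
Proof.
apply/le_anti/andP; split; last by apply: fmeet_lb; exact: sublocale_valP.
rewrite -[X in _ <= X]/(val (to_sublocale (fmeet_sublocale S))) -le_sublocale.
exact: le0x.
Qed.

Lemma val_fmeet_within N (NS : N `<=` S) :
  val (fmeet (sublocale_within NS)) = fmeet N.
Proof.
apply/le_anti/andP; split.
  apply: fmeet_ge => x Nx.
  rewrite -[X in _ <= X]/(val (to_sublocale (NS _ Nx))) -le_sublocale.
  exact: fmeet_lb.
apply: (@fmeet_lb _ _ (sublocale_set N)).
exact: fmeet_sublocale (sublocale_within NS).
Qed.

Lemma sublocale_nowhere_dense_inP N : sublocale_nowhere_dense_in N S <->
  N `<=` S /\ fimp (fmeet N) (fmeet S) = fmeet S.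
Proof.
split=> [[NS /sublocale_nowhere_denseP h]|[NS h]].
  split=> //; rewrite -[in RHS]val_sublocale_bot -h val_fimp.
  by rewrite val_sublocale_bot val_fmeet_within.
exists NS; apply/sublocale_nowhere_denseP; apply: val_inj.
by rewrite val_fimp val_sublocale_bot val_fmeet_within.
Qed.

End within.

Section maximal.
Context {d : Order.disp_t} {L : frameType d}.
Implicit Types (x : L) (N : sublocale L).

Lemma is_sublocale_closed x : is_sublocale [set y | x <= y].
Proof.
split=> [A xA|y s /= xs]; first exact: fmeet_ge.
exact: le_trans xs (le_fimpr y s).
Qed.

(** Both density conditions involve only least elements, and each [s] is the least element of the
    closed sublocale above it, so sublocale witnesses reduce to elements. *)
Lemma sublocale_maximal_nowhere_denseP N :
  sublocale_maximal_nowhere_dense N <->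
  fimp (fmeet N) \bot = \bot :> L /\
  ~ exists s : L, [/\ s <= fmeet N, fimp s \bot = \bot :> L
                     & fimp (fmeet N) s = s].
Proof.
rewrite /sublocale_maximal_nowhere_dense sublocale_nowhere_denseP.
split=> -[n0 nS]; split=> //; apply: contra_not nS.
- move=> [s [sn s0 ns]].
  pose S := Sublocale (is_sublocale_closed s).
  have Ss : fmeet S = s.
    by apply/le_anti/andP; split; [exact: fmeet_lb (lexx s)|exact: fmeet_ge].
  exists S; split; first by apply/sublocale_nowhere_denseP; rewrite Ss.
  apply/sublocale_nowhere_dense_inP; rewrite Ss; split=> // x Nx.
  exact: le_trans sn (fmeet_lb Nx).
- move=> [S [/sublocale_nowhere_denseP S0 /sublocale_nowhere_dense_inP[NS nS]]].
  exists (fmeet S); split=> //.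
  by apply: fmeet_lb; apply: NS; exact: fmeet_sublocale.
Qed.

End maximal.

Section space.
Context {X : topologicalType}.
Implicit Types (A F K : set X) (U V : opens X).

Lemma val_fimp_opens U V : val (fimp U V) = (~` val U `|` val V)°.
Proof.
apply/seteqP; split.
  rewrite -open_subsetE; last exact: opensP.
  have : (fimp U V `&` U <= V)%O by rewrite -fimpP.
  rewrite le_opens => /asboolP h x i.
  by have [Ux|] := pselect (val U x); [right; apply: h|left].
have : opens_interior (~` val U `|` val V) <= fimp U V.
  rewrite fimpP le_opens; apply/asboolP => x [/interior_subset[//|//]].
by rewrite le_opens => /asboolP.
Qed.

Lemma val_opens_bot : val (\bot%O : opens X) = set0.
Proof.
have := le0x (mkopens (@open0 X)).
by rewrite le_opens => /asboolP; rewrite subset0.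
Qed.

(** Interior is monotone, so the least member comes from the empty open set. *)
Lemma fmeet_induced F :
  val (fmeet (induced_sublocale F)) = ~` closure F.
Proof.
rewrite -interiorC; apply/seteqP; split.
  have : induced_set F (opens_interior (~` F)).
    by exists \bot%O => //; rewrite val_opens_bot setU0.
  by move=> /(@fmeet_lb _ _ (induced_set F)); rewrite le_opens => /asboolP.
have : opens_interior (~` F) <= fmeet (induced_sublocale F).
  apply: fmeet_ge => _ [G _ <-]; rewrite le_opens; apply/asboolP => /=.
  by apply: interiorS; exact: subsetUl.
by rewrite le_opens => /asboolP.
Qed.

Lemma closure_set_val F K :
  closure (set_val @^-1` F : set K) = set_val @^-1` closure (F `&` K).
Proof.
apply/seteqP; split=> u /=.
  move=> cu W; rewrite nbhsE => -[O [oO Ou] OW].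
  have [|v [Fv Ov]] := cu (set_val @^-1` O).
    by apply: open_nbhs_nbhs; split => //; exists O.
  by exists (set_val v); split; [split=> //; exact: set_valP|exact: OW].
move=> cu W; rewrite nbhsE => -[_ [[O oO <-] Ou] OW].
have [|x [[Fx Kx] Ox]] := cu O; first exact: open_nbhs_nbhs.
exists (exist _ x (mem_set Kx) : K); split; first exact: Fx.
by apply: OW; exact: Ox.
Qed.

(** Open sets of [K] are traces of open sets of [X], and, as [F] lies in [K], its closure in [K] is
    the trace of [closure F]. *)
Lemma nowhere_dense_inP F K : nowhere_dense_in F K <->
  F `<=` K /\ forall O, open O -> O `&` K `<=` closure F -> O `&` K = set0.
Proof.
split=> -[FK h]; split=> //; have FKE : F `&` K = F by apply/setIidPl.
  move=> O oO OF; rewrite -subset0 => x [Ox Kx].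
  pose u : K := exist _ x (mem_set Kx).
  suff : (closure (set_val @^-1` F : set K))° u by rewrite h.
  have : (set_val @^-1` O : set K) `<=` closure (set_val @^-1` F : set K).
    move=> v Ov; rewrite closure_set_val FKE; apply: OF.
    by split=> //; exact: set_valP.
  by rewrite open_subsetE; [apply; exact: Ox|exists O].
rewrite /nowhere_dense -subset0 => u.
have [O oO OE] := open_interior (closure (set_val @^-1` F : set K)).
rewrite -OE => Ou.
suff OK : O `&` K `<=` closure F.
  have : (O `&` K) (set_val u) by split=> //; exact: set_valP.
  by rewrite h.
move=> x [Ox Kx]; pose v : K := exist _ x (mem_set Kx).
have : (set_val @^-1` O : set K) v by [].
by rewrite OE => /interior_subset; rewrite closure_set_val FKE.
Qed.

(** The pseudocomplement of [U] is the interior of its complement, here the interior of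
    [closure F]. *)
Lemma nowhere_dense_fimp F U : val U = ~` closure F ->
  nowhere_dense F <-> fimp U \bot = \bot :> opens X.
Proof.
move=> UF; have E : val (fimp U \bot) = (closure F)°.
  by rewrite val_fimp_opens val_opens_bot UF setCK setU0.
split=> h; first by apply: val_inj; rewrite E h val_opens_bot.
by rewrite /nowhere_dense -E h val_opens_bot.
Qed.

Lemma nowhere_dense_in_nowhere_denseP F :
  (exists K, nowhere_dense K /\ nowhere_dense_in F K) <->
  exists V, [/\ V <= fmeet (induced_sublocale F), fimp V \bot = \bot :> opens X
              & fimp (fmeet (induced_sublocale F)) V = V].
Proof.
split=> [[K [K0 /nowhere_dense_inP[FK h]]]|[V [Vn V0 nV]]].
- exists (mkopens (closed_openC (@closed_closure _ K))); split.
  + rewrite le_opens; apply/asboolP; rewrite fmeet_induced /=.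
    exact/subsetC/closure_subset.
  + exact/(nowhere_dense_fimp K).
  + apply: val_inj; rewrite val_fimp_opens fmeet_induced setCK /=.
    apply/seteqP; split; last first.
      rewrite -open_subsetE; first exact: subsetUr.
      exact/closed_openC/closed_closure.
    (* The open set around [x] would meet [K] itself, but its trace on [K] lies in [closure F],
       hence is empty. *)
    move=> x xO xK.
    have [y yKO] := xK _ (open_nbhs_nbhs (conj (open_interior _) xO)).
    suff : set0 y by [].
    suff <- : (closure F `|` ~` closure K)° `&` K = set0 by rewrite setIC.
    apply: h (open_interior _) _ => z [/interior_subset[//|zK] Kz].
    by case: zK; exact: subset_closure.
- have cV : closed (~` val V) by apply/open_closedC/opensP.
  move: Vn; rewrite le_opens fmeet_induced => /asboolP VF.
  exists (~` val V); split.
    by apply/(nowhere_dense_fimp _ V) => //; rewrite -(closure_id _).1// setCK.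
  apply/nowhere_dense_inP; split=> [x Fx /VF|O oO OF].
    by apply; exact: subset_closure.
  rewrite -subset0 => x [Ox]; apply.
  rewrite -nV val_fimp_opens fmeet_induced setCK.
  (* The implication is the largest open set inside [closure F] joined with [val V]; containing [O],
     it puts [x] in [V]. *)
  suff : O `<=` closure F `|` val V by rewrite open_subsetE//; apply.
  by move=> y Oy; have [|] := pselect (val V y); [right|left; apply: OF].
Qed.

End space.

Theorem proposition2p10 (X : topologicalType) (hX : TD_space X) (F : set X) :
  maximal_nowhere_dense F <->
  sublocale_maximal_nowhere_dense (induced_sublocale F).
Proof.
rewrite sublocale_maximal_nowhere_denseP -nowhere_dense_in_nowhere_denseP.
by rewrite -(nowhere_dense_fimp _ _ (fmeet_induced F)).
Qed.
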